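(* Let $X$ be a locally convex space over $\mathbb{K}$ ($\mathbb{K}=\mathbb{R}$ or $\mathbb{C}$). Every generalized hyperbolic operator $T \in L(X)$ has the finite shadowing property. If, in addition, $X$ is sequentially complete, then $T$ also has the strict periodic shadowing property.
   Context: All topological vector spaces are Hausdorff. $\mathbb{N}_0=\{0,1,2,\dots\}$. $L(X)$ is the set of continuous linear operators on $X$. $X$ is the topological direct sum of subspaces $M,N$ if it is their algebraic direct sum and $(y,z)\mapsto y+z$ is a homeomorphism $M\times N\to X$. A family of seminorms $(\|\cdot\|_\alpha)_{\alpha\in I}$ is directed if for all $\alpha,\beta\in I$ there is $\gamma\in I$ with $\|\cdot\|_\alpha\le\|\cdot\|_\gamma$ and $\|\cdot\|_\beta\le\|\cdot\|_\gamma$. Generalized hyperbolic: let the topology of $X$ be induced by a directed family $(\|\cdot\|_\alpha)_{\alpha\in I}$ of seminorms (the notion does not depend on the choice of this family). $T\in L(X)$ is generalized hyperbolic if there is a topological direct sum decomposition $X=M\oplus N$ such that: (GH1) $T(M)\subset M$; (GH2) $T(N)\supset N$ and $T|_N:N\to T(N)$ is an isomorphism (linear homeomorphism); (GH3) for every $\alpha\in I$ there exist $\beta\in I$, $c>0$, $t\in(0,1)$ such that $\|T^ny\|_\alpha\le c\,t^n\|y\|_\beta$ and $\|S^nz\|_\alpha\le c\,t^n\|z\|_\beta$ for all $y\in M$, $z\in N$, $n\in\mathbb{N}_0$, where $S:=(T|_N)^{-1}|_N\in L(N)$. Shadowing: for a neighborhood $U$ of $0$, a $U$-chain for $T$ is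 a finite sequence $(x_j)_{j=0}^k$ ($k\ge1$) with $Tx_j-x_{j+1}\in U$ for $0\le j<k$; a sequence $(x_j)_{j\in\mathbb{N}_0}$ with $Tx_j-x_{j+1}\in U$ for all $j$ is a $U$-pseudotrajectory. $T$ has the finite shadowing property if for every neighborhood $V$ of $0$ there is a neighborhood $U$ of $0$ such that for every $U$-chain $(x_j)_{j=0}^k$ there is $x\in X$ with $x_j-T^jx\in V$ for all $0\le j\le k$. $T$ has the strict periodic shadowing property if for every neighborhood $V$ of $0$ there is a neighborhood $U$ of $0$ such that for every periodic $U$-pseudotrajectory $(x_j)_{j\in\mathbb{N}_0}$ of $T$, of period $k$, there is $x\in X$ with $T^kx=x$ and $x_j-T^jx\in V$ for all $j\in\mathbb{N}_0$. $X$ is sequentially complete if every Cauchy sequence in $X$ converges in $X$. *)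

(* Defs.v *)
From HB Require Import structures.
From mathcomp Require Import all_boot all_order all_algebra.
From mathcomp Require Import all_classical all_reals all_analysis.
From mathcomp Require Export complex.
Set Implicit Arguments.
Unset Strict Implicit.
Unset Printing Implicit Defensive.
Import Order.TTheory GRing.Theory Num.Theory numFieldNormedType.Exports.
Local Open Scope classical_set_scope.
Local Open Scope ring_scope.

(* Real quantities attached to a space over K are elements of K, as is usual
   for norms in the library.  When K = R[i], 0 <= r and r < s in K entail that
   r, resp. s - r, is a real number, so the order is that of the reals. *)

Section Seminorms.
Context {K : numFieldType} {X : tvsType K}.

Definition seminorm (p : X -> K) :=
  [/\ forall x, 0 <= p x,
      forall x y, p (x + y) <= p x + p y &
      forall (a : K) x, p (a *: x) = `|a| * p x].

Definition directed_family (I : Type) (p : I -> X -> K) :=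
  forall a b, exists c,
    (forall x, p a x <= p c x) /\ (forall x, p b x <= p c x).

(* The neighborhoods of x are the supersets of the finite intersections of
   p-balls centered at x; the empty intersection (n = 0) is the whole space. *)
Definition induces_topology (I : Type) (p : I -> X -> K) :=
  forall (x : X) (U : set X),
    nbhs x U <->
    exists (n : nat) (a : 'I_n -> I) (e : K),
      0 < e /\ [set y | forall i, p (a i) (y - x) < e] `<=` U.

Definition defining_seminorms (I : Type) (p : I -> X -> K) :=
  [/\ forall a, seminorm (p a), directed_family p & induces_topology p].

End Seminorms.

Definition homeomorphism (S T : topologicalType) (f : S -> T) :=
  continuous f /\
  exists g : T -> S, [/\ cancel f g, cancel g f & continuous g].

Section GeneralizedHyperbolic.
Context {K : numFieldType} {X : tvsType K}.
Implicit Types (M N : set X) (T : X -> X).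

(* A set coerces to the type of its elements, with the subspace topology. *)
Definition direct_sum_map M N : (M * N)%type -> X :=
  fun yz => \val yz.1 + \val yz.2.

Definition topological_direct_sum M N :=
  [/\ submod_closed (mem M), submod_closed (mem N),
      M `&` N = [set 0],
      forall x, exists y z, [/\ M y, N z & x = y + z] &
      homeomorphism (@direct_sum_map M N)].

(* T|_N : N -> T(N); it is linear whenever T is, hence a linear
   homeomorphism as soon as it is a homeomorphism. *)
Definition onto_image T N : N -> T @` N :=
  fun z => exist _ (T (\val z)) (mem_set (imageP T (set_valP z))).

(* (T|_N)^-1 : T(N) -> N, extended to a total function on X.  Where N is
   contained in T(N) it maps N into N, so its iterates on N are those of
   (T|_N)^-1|_N. *)
Definition restriction_inv T N : X -> X := 'pinv_(fun=> 0) N T.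

Definition generalized_hyperbolic (I : Type) (p : I -> X -> K)
    (T : {linear X -> X}) :=
  exists M N,
    [/\ topological_direct_sum M N,
        T @` M `<=` M,
        N `<=` T @` N /\ homeomorphism (@onto_image T N) &
        forall a, exists b (c t : K),
          [/\ 0 < c, 0 < t < 1,
              forall y n, M y -> p a (iter n T y) <= c * t ^+ n * p b y &
              forall z n, N z ->
                p a (iter n (restriction_inv T N) z) <= c * t ^+ n * p b z]].

End GeneralizedHyperbolic.

Section Shadowing.
Context {K : numFieldType} {X : tvsType K}.
Implicit Types (U V : set X) (T : X -> X) (x : nat -> X).

(* The chain is x 0, ..., x k; the later values of x are irrelevant. *)
Definition chain U T (k : nat) x :=
  (0 < k)%N /\ forall j, (j < k)%N -> U (T (x j) - x j.+1).

Definition pseudotrajectory U T x := forall j, U (T (x j) - x j.+1).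

Definition periodic x (k : nat) := (0 < k)%N /\ forall j, x (j + k)%N = x j.

Definition finite_shadowing T :=
  forall V, nbhs 0 V -> exists2 U, nbhs 0 U &
    forall k x, chain U T k x ->
      exists y : X, forall j, (j <= k)%N -> V (x j - iter j T y).

Definition strict_periodic_shadowing T :=
  forall V, nbhs 0 V -> exists2 U, nbhs 0 U &
    forall k x, pseudotrajectory U T x -> periodic x k ->
      exists y : X, iter k T y = y /\ forall j, V (x j - iter j T y).

End Shadowing.

(* Cauchy for the translation-invariant uniformity: the uniform structure
   carried by a tvsType is only required to be compatible with the topology,
   so the library's cauchy would not be the right notion here. *)
Definition cauchy_sequence {K : numFieldType} {X : tvsType K} (u : nat -> X) :=
  forall V : set X, nbhs 0 V ->
    exists n0, forall m n, (n0 <= m)%N -> (n0 <= n)%N -> V (u m - u n).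

Definition sequentially_complete {K : numFieldType} (X : tvsType K) :=
  forall u : nat -> X, cauchy_sequence u -> exists l : X, u @ \oo --> l.

(* Main.v *)
(* Let [P], [Q] be the projections onto [M], [N] and [d j = T (x j) - x j.+1]
   the errors of a chain or pseudotrajectory. Any solution [w] of
   [w j.+1 = T (w j) + d j] makes [x + w] a trajectory, so it suffices to find a
   small one. Pushing the [M]-parts of past errors forward and pulling the
   [N]-parts of future errors back gives
     [w j = sum_(i >= 0) T^i P d_(j-1-i) - sum_(i >= 0) S^(i+1) Q d_(j+i)],
   which (GH3) bounds by geometric series. For a chain the errors outside of
   the chain are replaced by zero and the sums are finite. For a periodic
   pseudotrajectory the indices are read modulo the period and the series
   converge by sequential completeness, so that [w], hence the trajectory
   [x + w], is periodic. *)
Require Import Defs.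
From mathcomp Require Import all_boot all_order all_algebra.
From mathcomp Require Import all_classical all_reals all_analysis.
Set Implicit Arguments.
Unset Strict Implicit.
Unset Printing Implicit Defensive.
Import Order.TTheory GRing.Theory Num.Theory numFieldNormedType.Exports.
Local Open Scope classical_set_scope.
Local Open Scope ring_scope.

(** * Decay of powers in the scalar field *)

Definition powers_vanish (K : numFieldType) :=
  forall t e : K, 0 < t < 1 -> 0 < e -> exists n, t ^+ n < e.

(** A general [numFieldType] may be non-Archimedean. In the complex case [0 < t < 1] and [0 < e]
    force zero imaginary parts, which reduces the claim to [R]. *)
Lemma powers_vanish_real_complex (R : realType) (K : numFieldType) :
  K = R :> numFieldType \/ K = R[i]%C :> numFieldType -> powers_vanish K.
Proof.
have realP (t e : R) : 0 < t < 1 -> 0 < e -> exists n, t ^+ n < e.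
  move=> /andP[t0 t1] e0.
  have tn0 : (t ^+ n @[n --> \oo] --> 0)%classic.
    by apply: cvg_expr; rewrite gtr0_norm.
  have /cvgrPdist_lt/(_ e e0)[n _ /(_ n (leqnn n))] := tn0.
  by rewrite /= sub0r normrN gtr0_norm ?exprn_gt0//; exists n.
case=> -> // t e /andP[].
case: t => a b; case: e => c d.
rewrite !ltcE /= => /andP[/eqP-> a0] /andP[_ a1] /andP[/eqP-> c0].
have [|n ltn] := realP a c _ c0; first by rewrite a0.
exists n.
have -> : (a +i* 0)%C = real_complex R a by [].
by rewrite -rmorphXn ltcE /= eqxx.
Qed.

(** * Seminorms and geometric sums *)

Section SeminormTheory.
Context {K : numFieldType} {X : tvsType K}.
Variables (p : X -> K) (p_seminorm : seminorm p).

Lemma seminorm0 : p 0 = 0.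
Proof. by case: p_seminorm => _ _ pZ; rewrite -(scale0r 0) pZ normr0 mul0r. Qed.

Lemma seminormN x : p (- x) = p x.
Proof.
by case: p_seminorm => _ _ pZ; rewrite -scaleN1r pZ normrN normr1 mul1r.
Qed.

Lemma seminormB x y : p (x - y) <= p x + p y.
Proof. by case: p_seminorm => _ pD _; rewrite -(seminormN y) pD. Qed.

Lemma seminorm_geometric_sum (v : nat -> X) (D t : K) (m n : nat) :
  0 <= D -> 0 < t < 1 ->
  (forall i, (m <= i < n)%N -> p (v i) <= D * t ^+ i) ->
  p (\sum_(m <= i < n) v i) <= D * t ^+ m / (1 - t).
Proof.
move=> D0 /andP[t0 t1] vD; have t1' : 0 < 1 - t by rewrite subr_gt0.
have [nm|mn] := leqP n m.
  by rewrite big_geq// seminorm0 divr_ge0 ?mulr_ge0 ?exprn_ge0// ltW.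
apply: le_trans (_ : _ <= \sum_(m <= i < n) D * t ^+ i) _.
  rewrite big_nat_cond [leRHS]big_nat_cond.
  elim/big_ind2 : _ => [|x a y b xa yb|i /andP[/vD]//].
    by rewrite seminorm0.
  by case: p_seminorm => _ pD _; rewrite (le_trans (pD _ _))// lerD.
rewrite -mulr_sumr -mulrA ler_wpM2l// ler_pdivlMr// mulr_suml.
(* After multiplication by [1 - t] the sum telescopes to [t ^+ m - t ^+ n]. *)
rewrite (eq_bigr (fun i => - t ^+ i.+1 - - t ^+ i)); last first.
  by move=> i _; rewrite mulrBr mulr1 opprK exprSr addrC.
rewrite telescope_sumr 1?ltnW// opprK addrC lerBlDr lerDl exprn_ge0// ltW//.
Qed.

End SeminormTheory.

(** * Limits and series with respect to defining seminorms *)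

Section DefiningSeminorms.
Context {K : numFieldType} {X : tvsType K} {I : Type}.
Variables (p : I -> X -> K) (p_defining : defining_seminorms p).

Let p_seminorm a : seminorm (p a).
Proof. by case: p_defining. Qed.

Lemma nbhs_seminorm_ball a x (e : K) :
  0 < e -> nbhs x [set y | p a (y - x) < e].
Proof.
case: p_defining => _ _ topP e0; apply/topP.
by exists 1%N, (fun=> a), e; split=> // y /(_ ord0).
Qed.

(** Transfers bounds on partial sums to the sum of a series: [p a l] exceeds [p a (u n)] by at most
    [p a (u n - l)]. *)
Lemma seminorm_cvg_le a (u : nat -> X) l (B : K) :
  u @ \oo --> l -> (forall n, p a (u n) <= B) -> p a l <= B.
Proof.
move=> ul uB; apply/ler_addgt0Pr => e e0.
have [n _ /(_ n (leqnn n)) /= une] := ul _ (nbhs_seminorm_ball a l e0).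
rewrite -(subKr (u n) l) (le_trans (seminormB _ _ _))// lerD// ltW//.
Qed.

Hypothesis K_powers : powers_vanish K.
Hypothesis X_complete : sequentially_complete X.

Lemma geometric_series_cvg (v : nat -> X) :
  (forall a, exists (D t : K),
    [/\ 0 <= D, 0 < t < 1 & forall i, p a (v i) <= D * t ^+ i]) ->
  exists l : X, (fun n => \sum_(0 <= i < n) v i) @ \oo --> l.
Proof.
move=> vP; apply: X_complete => V V0.
case: p_defining => _ _ /(_ 0 V)[+ _] => /(_ V0)[n [a [e [e0 aV]]]].
have /choice[N NP] : forall i : 'I_n, exists N, forall m k, (N <= m)%N ->
    (m <= k)%N -> p (a i) (\sum_(m <= j < k) v j) < e.
  move=> i; have [D [t [D0 t01 vD]]] := vP (a i).
  have /andP[t0 t1] := t01; have t1' : 0 < 1 - t by rewrite subr_gt0.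
  (* [D] may be zero, so the threshold is divided by [D + 1]. *)
  have D1 : 0 < D + 1 by rewrite ltr_wpDl.
  have [|N tN] := K_powers (e := e * (1 - t) / (D + 1)) t01.
    by rewrite divr_gt0// mulr_gt0.
  exists N => m k Nm mk.
  apply: le_lt_trans (seminorm_geometric_sum _ D0 t01 _) _ => //.
  rewrite ltr_pdivrMr//; apply: le_lt_trans (_ : (D + 1) * t ^+ N < _).
    apply: ler_pM => //; first by rewrite exprn_ge0// ltW.
      by rewrite lerDl.
    by apply: ler_wiXn2l; rewrite ?ltW.
  by rewrite mulrC -ltr_pdivlMr.
exists (\max_i N i)%N => m k Nm Nk; apply: aV => i /=; rewrite subr0.
have Ni l : (\max_i N i <= l)%N -> (N i <= l)%N.
  exact: leq_trans (leq_bigmax i).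
have [mk|/ltnW km] := leqP m k.
  rewrite (big_cat_nat (leq0n m) mk) /= opprD addrA subrr sub0r.
  by rewrite seminormN// NP// Ni.
by rewrite (big_cat_nat (leq0n k) km) /= addrAC subrr add0r NP// Ni.
Qed.

End DefiningSeminorms.

(** * From generalized hyperbolicity to a splitting with estimates *)

Section HyperbolicSplitting.
Context {K : numFieldType} {X : tvsType K} {I : Type}.
Variables (p : I -> X -> K) (p_defining : defining_seminorms p).
Variable T : {linear X -> X}.

Lemma corrected_orbit (x w : nat -> X) k :
  (forall j, (j < k)%N -> w j.+1 = T (w j) + (T (x j) - x j.+1)) ->
  forall j, (j <= k)%N -> iter j T (x 0%N + w 0%N) = x j + w j.
Proof.
move=> wP; elim=> // j IH jk; rewrite iterS IH 1?ltnW// wP// raddfD /=.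
by rewrite [RHS]addrCA [X in _ = _ + X]addrC subrK addrC.
Qed.

(* [P] and [Q] stand for the projections onto [M] and [N], [S] for an extension
   of the inverse of [T] on [N]; [q a] absorbs the constant and the auxiliary
   seminorm of (GH3), so that only its smallness near [0] matters. *)
Definition hyperbolic_splitting (P Q S : X -> X) (q : I -> X -> K)
    (t : I -> K) :=
  [/\ forall x, P x + Q x = x,
      forall x n, T (S (iter n S (Q x))) = iter n S (Q x) &
      forall a, [/\ 0 < t a < 1, forall x, 0 <= q a x,
        forall e, 0 < e -> nbhs 0 [set x | q a x < e] &
        forall x n, p a (iter n T (P x)) <= q a x * t a ^+ n /\
                    p a (iter n.+1 S (Q x)) <= q a x * t a ^+ n]].

Lemma generalized_hyperbolic_splitting : generalized_hyperbolic p T ->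
  exists P Q S q t, hyperbolic_splitting P Q S q t.
Proof.
case: (p_defining) => p_seminorm _ _.
move=> [M [N [[M_sub N_sub _ _ [_ [g [sumK gK g_cont]]]] TM [NT _] TSP]]].
have ptP a : exists bct : I * K * K, [/\ 0 < bct.1.2, 0 < bct.2 < 1,
    forall y n, M y -> p a (iter n T y) <= bct.1.2 * bct.2 ^+ n * p bct.1.1 y &
    forall z n, N z -> p a (iter n (restriction_inv T N) z) <=
      bct.1.2 * bct.2 ^+ n * p bct.1.1 z].
  by have [b [c [t ?]]] := TSP a; exists (b, c, t).
have [f fP] := choice ptP.
pose b a := (f a).1.1; pose c a := (f a).1.2; pose t a := (f a).2.
pose P x := \val (g x).1; pose Q x := \val (g x).2.
have MP x : M (P x) by apply: set_valP.
have NQ x : N (Q x) by apply: set_valP.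
have M0 : M 0 by case: M_sub => /set_mem.
have N0 : N 0 by case: N_sub => /set_mem.
(* [g] is only known as an inverse map, so its value at 0 comes from injectivity of the sum map. *)
have g0 : g 0 = (exist _ 0 (mem_set M0), exist _ 0 (mem_set N0)).
  by apply: (can_inj sumK); rewrite gK /direct_sum_map /= addr0.
have P0 : P 0 = 0 by rewrite /P g0.
have Q0 : Q 0 = 0 by rewrite /Q g0.
have P_cont : P x @[x --> 0] --> P 0.
  apply: (cvg_comp g (fun yz => \val yz.1) (g_cont 0)).
  apply: (cvg_comp fst val (G := nbhs (g 0).1)); first exact: cvg_fst.
  exact: (@initial_continuous _ _ (set_val : M -> X)).
have Q_cont : Q x @[x --> 0] --> Q 0.
  apply: (cvg_comp g (fun yz => \val yz.2) (g_cont 0)).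
  apply: (cvg_comp snd val (G := nbhs (g 0).2)); first exact: cvg_snd.
  exact: (@initial_continuous _ _ (set_val : N -> X)).
set S := restriction_inv T N in fP.
have NS z : N z -> N (S z).
  move=> Nz; apply: (surjpinv_image_sub (B := T @` N) (f := T)) => //.
  by exists z => //; exact: NT.
have TS z : N z -> T (S z) = z.
  by move=> Nz; apply: pinvK; apply/mem_set/NT.
have NSn z n : N z -> N (iter n S z).
  by move=> Nz; elim: n => //= n; exact: NS.
exists P, Q, S, (fun a x => c a * (p (b a) (P x) + p (b a) (Q x))), t.
split=> [x|x n|a]; first exact: gK.
  by rewrite TS//; apply: NSn.
have [c0 t01 Tle Sle] := fP a; rewrite -/(b a) -/(c a) -/(t a) in c0 t01 Tle Sle.
have pb0 x : 0 <= p (b a) x by case: (p_seminorm (b a)).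
have t0 n : 0 <= t a ^+ n by case/andP: t01 => /ltW/(exprn_ge0 n).
split=> //.
- by move=> x; rewrite mulr_ge0 ?addr_ge0// ltW.
- move=> e e0; have e0' : 0 < e / c a / 2 by rewrite !divr_gt0.
  have Pn := P_cont _ (nbhs_seminorm_ball p_defining (b a) (P 0) e0').
  have Qn := Q_cont _ (nbhs_seminorm_ball p_defining (b a) (Q 0) e0').
  apply: (filterS2 (nbhs_filter (0 : X)) _ Qn Pn) => x /=.
  rewrite P0 Q0 !subr0 => Qx Px.
  by rewrite -ltr_pdivlMl// mulrC [ltRHS]splitr ltrD.
- move=> x n; split.
    apply: le_trans (Tle _ n (MP x)) _.
    by rewrite mulrAC ler_wpM2r// ler_wpM2l ?(ltW c0)// lerDl.
  apply: le_trans (Sle _ n.+1 (NQ x)) _.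
  (* [S] is iterated [n.+1] times; the surplus factor [t a <= 1] is dropped. *)
  have /andP[/ltW ta0 /ltW ta1] := t01.
  apply: le_trans (_ : c a * t a ^+ n * p (b a) (Q x) <= _).
    by rewrite ler_wpM2r// ler_wpM2l ?(ltW c0)// exprS ler_piMl.
  by rewrite mulrAC ler_wpM2r// ler_wpM2l ?(ltW c0)// lerDr.
Qed.

(** * Shadowing from the splitting *)

Section Splitting.
Context {P Q S : X -> X} {q : I -> X -> K} {t : I -> K}.
Hypothesis PQS : hyperbolic_splitting P Q S q t.

(** Chooses [U] for both shadowing properties; the two summands are the geometric bounds for the
    [P]- and [Q]-parts of the correction. *)
Lemma splitting_nbhs V : nbhs 0 V -> exists2 U, nbhs 0 U &
  forall y, (forall a D, 0 <= D -> (forall x, U x -> q a x <= D) ->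
    p a y <= D / (1 - t a) + D / (1 - t a)) -> V y.
Proof.
move=> V0; case: p_defining => _ _ /(_ 0 V)[+ _] => /(_ V0)[n [a [e [e0 aV]]]].
have [_ _ PQSa] := PQS.
(* The two summands then add up to [2 * e / 3], strictly below [e]. *)
pose D i := e / 3 * (1 - t (a i)).
have D0 i : 0 < D i.
  have [/andP[_ t1] _ _ _] := PQSa (a i).
  by rewrite mulr_gt0 ?divr_gt0 ?subr_gt0.
exists [set x | forall i, q (a i) x < D i].
  by apply: filter_forall => i; have [_ _ + _] := PQSa (a i); apply.
move=> y yP; apply: aV => i /=; rewrite subr0.
apply: le_lt_trans (yP _ (D i) (ltW (D0 i)) _) _; first by move=> x /(_ i)/ltW.
have [/andP[_ t1] _ _ _] := PQSa (a i).
rewrite /D mulfK ?gt_eqF ?subr_gt0// -mulrDl ltr_pdivrMr//.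
by rewrite -mulr2n -[ltLHS]mulr_natr ltr_pM2l// ltr_nat.
Qed.

Lemma splitting_sum_le a (D : K) (d : nat -> X) n :
  0 <= D -> (forall i, (i < n)%N -> q a (d i) <= D) ->
  p a (\sum_(0 <= i < n) iter i T (P (d i))) <= D / (1 - t a) /\
  p a (\sum_(0 <= i < n) iter i.+1 S (Q (d i))) <= D / (1 - t a).
Proof.
have [_ _ /(_ a)[t01 _ _ TS]] := PQS; case: p_defining => p_seminorm _ _.
have /andP[t0 _] := t01.
move=> D0 dD; rewrite -[X in X / _]mulr1 -(expr0 (t a)); split;
  apply: seminorm_geometric_sum => // i /andP[_ /dD qD].
- by apply: le_trans (TS _ _).1 _; rewrite ler_wpM2r// exprn_ge0// ltW.
- by apply: le_trans (TS _ _).2 _; rewrite ler_wpM2r// exprn_ge0// ltW.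
Qed.

Lemma splitting_finite_shadowing : finite_shadowing T.
Proof.
move=> V /splitting_nbhs[U U0 UV]; exists U => // k x [_ xU].
have [PQ TS _] := PQS; case: p_defining => p_seminorm _ _.
pose d j := T (x j) - x j.+1.
pose h j := \sum_(0 <= i < j) iter i T (P (d (j - i.+1)%N)).
pose g j := \sum_(0 <= i < k - j) iter i.+1 S (Q (d (j + i)%N)).
have hS j : h j.+1 = P (d j) + T (h j).
  by rewrite /h big_nat_recl//= subSS subn0 raddf_sum.
(* [T] cancels one [S] in each term; [j < k] makes the sum nonempty, and its first term becomes
   [Q (d j)]. *)
have gS j : (j < k)%N -> T (g j) = Q (d j) + g j.+1.
  move=> jk; rewrite /g raddf_sum -subnSK// big_nat_recl//= (TS _ 0%N) addn0.
  by congr (_ + _); apply: eq_bigr => i _; rewrite /= (TS _ i.+1) addnS.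
have wP j : (j < k)%N -> h j.+1 - g j.+1 = T (h j - g j) + d j.
  by move=> jk; rewrite hS -[X in _ - X](addKr (Q (d j))) -gS//
    opprD opprK addrACA PQ raddfB addrC.
exists (x 0%N + (h 0%N - g 0%N)) => j jk.
rewrite (corrected_orbit wP)// opprD addNKr.
apply: UV => a D D0 UD; rewrite seminormN//.
apply: le_trans (seminormB _ _ _) _ => //; apply: lerD.
- apply: (splitting_sum_le (d := fun i => d (j - i.+1)%N) _ _).1 => // i ij.
  apply/UD/xU; rewrite (leq_trans _ jk)// ltn_subrL/=.
  exact: leq_trans ij.
- apply: (splitting_sum_le (d := fun i => d (j + i)%N) _ _).2 => // i ij.
  by apply/UD/xU; rewrite -ltn_subRL.
Qed.

Hypothesis X_hausdorff : hausdorff_space X.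
Hypothesis T_continuous : continuous T.
Hypothesis K_powers : powers_vanish K.
Hypothesis X_complete : sequentially_complete X.

Lemma cvg_affine (u : nat -> X) (l c : X) :
  u @ \oo --> l -> (fun n => c + T (u n)) @ \oo --> c + T l.
Proof.
move=> ul; apply: (@continuous2_cvg _ X X X _ _ _ _ +%R).
- exact: (add_continuous (c, T l)).
- exact: cvg_cst.
- exact: (cvg_comp u T ul (@T_continuous l)).
Qed.

Lemma splitting_periodic_shadowing : strict_periodic_shadowing T.
Proof.
move=> V /splitting_nbhs[U U0 UV]; exists U => // k x xU [k0 xk].
have [PQ TS PQSa] := PQS; case: p_defining => p_seminorm _ _.
pose d j := T (x j) - x j.+1.
have dk j : d (j + k)%N = d j by rewrite /d -addSn !xk.
have dmod j : d j = d (j %% k)%N.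
  rewrite [in LHS](divn_eq j k) addnC.
  by elim: (j %/ k)%N => [|m IH]; rewrite ?addn0// mulSn addnCA addnC dk.
(* The sum over one period bounds every value. This [D] serves convergence only; smallness comes
   from [U] at the end. *)
have d_bounded a : exists2 D, 0 <= D & forall j, q a (d j) <= D.
  have q0 y : 0 <= q a y by case: (PQSa a).
  exists (\sum_(i < k) q a (d i)) => [|j]; first exact: sumr_ge0.
  rewrite dmod (bigD1 (Ordinal (ltn_pmod j k0))) //= lerDl.
  exact: sumr_ge0.
(* Modulo [k], the index [j + k.-1 * i.+1] is [j - i.+1]. *)
pose dh j i := d (j + k.-1 * i.+1)%N.
pose dg j i := d (j + i)%N.
pose h j m := \sum_(0 <= i < m) iter i T (P (dh j i)).
pose g j m := \sum_(0 <= i < m) iter i.+1 S (Q (dg j i)).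
have hl j : exists l : X, h j @ \oo --> l.
  apply: (geometric_series_cvg p_defining) => // a.
  have [D D0 dD] := d_bounded a; have [t01 _ _ TSle] := PQSa a.
  exists D, (t a); split=> // i; apply: le_trans (TSle _ _).1 _.
  by rewrite ler_wpM2r ?dD// exprn_ge0//; case/andP: t01 => /ltW.
have gl j : exists l : X, g j @ \oo --> l.
  apply: (geometric_series_cvg p_defining) => // a.
  have [D D0 dD] := d_bounded a; have [t01 _ _ TSle] := PQSa a.
  exists D, (t a); split=> // i; apply: le_trans (TSle _ _).2 _.
  by rewrite ler_wpM2r ?dD// exprn_ge0//; case/andP: t01 => /ltW.
have [hh hhP] := choice hl; have [gg ggP] := choice gl.
have lim_eq (u : nat -> X) (l l' : X) : u @ \oo --> l -> u @ \oo --> l' -> l = l'.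
  by move=> ul ul'; apply: (cvg_unique X_hausdorff ul ul').
have shift (u : nat -> X) (l : X) : u @ \oo --> l -> u n.+1 @[n --> \oo] --> l.
  exact: cvg_comp (@cvg_addnl 1).
(* The first index on the left is [j + k], and the later ones exceed those of [h j] by [k], so
   periodicity of [d] matches the terms. *)
have hS j m : h j.+1 m.+1 = P (d j) + T (h j m).
  rewrite /h big_nat_recl// raddf_sum /dh muln1 addSnnS prednK// dk.
  congr (_ + _); apply: eq_bigr => i _ /=; congr (T (iter i T (P _))).
  rewrite -[RHS]dk; congr d.
  by rewrite mulnS addSnnS -addSn prednK// (addnC k) addnA.
have gS j m : Q (d j) + g j.+1 m = T (g j m.+1).
  rewrite /g raddf_sum big_nat_recl//= (TS _ 0%N) /dg addn0; congr (_ + _).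
  by apply: eq_bigr => i _; rewrite /= (TS _ i.+1) addnS.
(* Both sides are limits of the same sequence, by continuity of [T]; the space being Hausdorff, they
   agree. *)
have hhS j : hh j.+1 = P (d j) + T (hh j).
  apply: (lim_eq (fun m => h j.+1 m.+1)).
    exact: shift.
  under eq_fun do rewrite hS.
  exact: cvg_affine.
have ggS j : gg j.+1 = - Q (d j) + T (gg j).
  apply: (lim_eq _ _ _ (ggP j.+1)).
  have -> : g j.+1 = fun m => - Q (d j) + T (g j m.+1).
    by apply/funext => m; rewrite -gS addKr.
  by apply: cvg_affine; exact: shift.
have wP j : hh j.+1 - gg j.+1 = T (hh j - gg j) + d j.
  by rewrite hhS ggS opprD opprK addrACA PQ raddfB addrC.
have orbit j : iter j T (x 0%N + (hh 0%N - gg 0%N)) = x j + (hh j - gg j).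
  exact: (corrected_orbit (k := j) (w := fun j => hh j - gg j)).
exists (x 0%N + (hh 0%N - gg 0%N)); split.
  (* The limits were chosen separately for each index, so [hh k = hh 0] and [gg k = gg 0] follow
     from equality of the partial sums and uniqueness of limits. *)
  rewrite orbit -{1}[k]add0n xk; congr (_ + (_ - _)).
    apply: lim_eq (hhP k) _; suff -> : h k = h 0%N by exact: hhP.
    by apply/funext => m; apply: eq_bigr => i _; rewrite /dh addnC dk.
  apply: lim_eq (ggP k) _; suff -> : g k = g 0%N by exact: ggP.
  by apply/funext => m; apply: eq_bigr => i _; rewrite /dg addnC dk.
move=> j; rewrite orbit opprD addNKr.
apply: UV => a D D0 UD; rewrite seminormN//.
apply: le_trans (seminormB _ _ _) _ => //.
have qD i : q a (d i) <= D by apply/UD/xU.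
apply: lerD.
- apply: (seminorm_cvg_le p_defining (hhP j)) => m.
  by apply: (splitting_sum_le (d := dh j) _ _).1 => // i _; apply: qD.
- apply: (seminorm_cvg_le p_defining (ggP j)) => m.
  by apply: (splitting_sum_le (d := dg j) _ _).2 => // i _; apply: qD.
Qed.

End Splitting.
End HyperbolicSplitting.

Theorem theorem2 (R : realType) (K : numFieldType)
    (K_real_or_complex : K = R :> numFieldType \/ K = R[i]%C :> numFieldType)
    (X : tvsType K) (X_hausdorff : hausdorff_space X)
    (I : Type) (p : I -> X -> K) (p_defining : defining_seminorms p)
    (T : {linear X -> X}) (T_continuous : continuous T)
    (T_GH : generalized_hyperbolic p T) :
  finite_shadowing T /\
  (sequentially_complete X -> strict_periodic_shadowing T).
Proof.
have K_powers := powers_vanish_real_complex K_real_or_complex.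
have [P [Q [S [q [t PQS]]]]] :=
  generalized_hyperbolic_splitting p_defining T_GH.
split=> [|X_complete]; first exact: splitting_finite_shadowing PQS.
exact: splitting_periodic_shadowing PQS _ _ _ _.
Qed.
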